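(* Let $(A,\cdot,\Phi=\{\partial_k\}_{k=1}^m)$ be a differential algebra and let $(V,l,r)$ be an $A$-bimodule. Suppose that $\Pi=\{\beta_k\colon V\to V\}_{k=1}^m$ is admissible to $(A,\cdot,\Phi)$ on $(V,l,r)$, and hence $(V^*,r^*,l^*,\Pi^* )$ is a bimodule of $(A,\cdot,\Phi)$. Let $\Psi=\{\eth_k\colon A\to A\}_{k=1}^m$ and $\Omega=\{\alpha_k\colon V\to V\}_{k=1}^m$ be sets of commuting linear maps. Let $T\colon V\to A$ be a linear map. (1) The element $T-\sigma(T)$ is an antisymmetric solution of the $(\Psi+\Omega^* )$-admissible AYBE in the differential algebra $(A\ltimes_{r^*,l^*}V^*,\cdot,\Phi+\Pi^* )$ if and only if $T$ is an $\mathcal O$-operator of the algebra $(A,\cdot)$ associated to $(V,l,r)$ such that $\partial_kT=T\alpha_k$ and $T\beta_k=\eth_kT$ for all $k=1,\dots,m$. (2) Assume that $(V,l,r,\Omega)$ is a bimodule of $(A,\cdot,\Phi)$. If $T$ is an $\mathcal O$-operator of the differential algebra $(A,\cdot,\Phi)$ associated to $(V,l,r,\Omega)$ and $T\beta_k=\eth_kT$ for all $k=1,\dots,m$, then $T-\sigma(T)$ is an antisymmetric solution of the $(\Psi+\Omega^* )$-admissible AYBE in the differential algebra $(A\ltimes_{r^*,l^*}V^*,\cdot,\Phi+\Pi^* )$. If in addition $(A,\cdot,\Phi)$ is $\Psi$-admissible and, for all $a\in A$, $v\in V$, $k=1,\dots,m$, $$l(\eth_k(a))v=l(a)\alpha_k(v)+\beta_k(l(a)v),\qquad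 r(\eth_k(a))v=r(a)\alpha_k(v)+\beta_k(r(a)v),$$ then the differential algebra $(A\ltimes_{r^*,l^*}V^*,\cdot,\Phi+\Pi^* )$ is $(\Psi+\Omega^* )$-admissible. Therefore in this case there is a differential ASI bialgebra $(A\ltimes_{r^*,l^*}V^*,\cdot,\Delta,\Phi+\Pi^*,\Psi+\Omega^* )$, where, writing $\hat A=A\ltimes_{r^*,l^*}V^*$, $\Delta(x)=(\mathrm{id}\otimes L_{\hat A}(x)-R_{\hat A}(x)\otimes\mathrm{id})(T-\sigma(T))$ for all $x\in\hat A$.
   Context: All vector spaces and algebras are finite-dimensional over a field $\mathbb F$ of characteristic $0$; ''algebra'' means associative algebra, not necessarily unital. Transposes of linear maps are denoted by $*$; for $\mu\colon A\to\mathrm{End}(V)$, $\mu^*(a)=\mu(a)^*$ (no sign); $\Pi^*=\{\beta_k^*\}$, $\Omega^*=\{\alpha_k^*\}$. $L_A(a)b=a\cdot b=R_A(b)a$. $\sigma$ is the flip; an element $s$ of a tensor square is antisymmetric if $s=-\sigma(s)$. For families of maps on $V_1$ and $V_2$, $\{\alpha_k\}+\{\beta_k\}$ is the family of maps $v_1+v_2\mapsto\alpha_k(v_1)+\beta_k(v_2)$ on $V_1\oplus V_2$. $A$-bimodule $(V,l,r)$: $l(a)l(b)=l(a\cdot b)$, $r(b)r(a)=r(a\cdot b)$, $r(b)l(a)=l(a)r(b)$. Semi-direct product algebra $A\ltimes_{l,r}V$: $A\oplus V$ with $(a+u)\cdot(b+v)=a\cdot b+l(a)v+r(b)u$; $A\ltimes_{r^*,l^*}V^*$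 is the one for the bimodule $(V^*,r^*,l^* )$. Differential algebra $(A,\cdot,\Phi=\{\partial_k\}_{k=1}^m)$: $(A,\cdot)$ algebra, $\partial_k$ pairwise commuting derivations. A bimodule of $(A,\cdot,\Phi)$ is $(V,l,r,\{\alpha_k\})$ with $(V,l,r)$ an $A$-bimodule and pairwise commuting $\alpha_k\in\mathrm{End}(V)$ such that $\alpha_k(l(a)v)=l(\partial_k(a))v+l(a)\alpha_k(v)$, $\alpha_k(r(a)v)=r(\partial_k(a))v+r(a)\alpha_k(v)$. A set $\Pi=\{\beta_k\}$ of commuting linear maps on $V$ is admissible to $(A,\cdot,\Phi)$ on $(V,l,r)$ if $(V^*,r^*,l^*,\Pi^* )$ is a bimodule of $(A,\cdot,\Phi)$; equivalently $r(a)\beta_k(v)=r(\partial_k(a))v+\beta_k(r(a)v)$ and $l(a)\beta_k(v)=l(\partial_k(a))v+\beta_k(l(a)v)$. $(A,\cdot,\Phi)$ is $\Psi$-admissible if $\Psi$ is admissible to it on $(A,L_A,R_A)$, i.e. $\eth_k(a)\cdot b=a\cdot\partial_k(b)+\eth_k(a\cdot b)$ and $a\cdot\eth_k(b)=\partial_k(a)\cdot b+\eth_k(a\cdot b)$. $T\colon V\to A$ is an $\mathcal O$-operator of $(A,\cdot)$ associated to $(V,l,r)$ if $T(u)\cdot T(v)=T(l(T(u))v+r(T(v))u)$ for all $u,v\in V$; it is an $\mathcal O$-operator of $(A,\cdot,\Phi)$ associated to the bimodule $(V,l,r,\Omega)$ if moreover $\partial_kT=T\alpha_k$ for all $k$.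 $T$ is identified with the element $\sum_iT(v_i)\otimes v_i^*\in A\otimes V^*\subset(A\ltimes_{r^*,l^*}V^* )^{\otimes2}$, where $\{v_i\}$ is a basis of $V$ with dual basis $\{v_i^*\}$. For a differential algebra $(A,\cdot,\{\partial_k\})$ and commuting maps $\Psi=\{\eth_k\}$, $s=\sum_ia_i\otimes b_i$ is a solution of the $\Psi$-admissible AYBE if $s_{12}s_{13}+s_{13}s_{23}-s_{23}s_{12}=0$, where $s_{12}s_{13}=\sum a_i\cdot a_j\otimes b_i\otimes b_j$, $s_{13}s_{23}=\sum a_i\otimes a_j\otimes b_i\cdot b_j$, $s_{23}s_{12}=\sum a_j\otimes a_i\cdot b_j\otimes b_i$, and $(\partial_k\otimes\mathrm{id}-\mathrm{id}\otimes\eth_k)(s)=0=(\eth_k\otimes\mathrm{id}-\mathrm{id}\otimes\partial_k)(s)$ for all $k$. ASI bialgebra $(A,\cdot,\Delta)$: $(A,\cdot)$ algebra, $(A,\Delta)$ coassociative coalgebra (counit not required), $\Delta(a\cdot b)=(R_A(b)\otimes\mathrm{id})\Delta(a)+(\mathrm{id}\otimes L_A(a))\Delta(b)$ and $(L_A(a)\otimes\mathrm{id}-\mathrm{id}\otimes R_A(a))\Delta(b)=\sigma((\mathrm{id}\otimes R_A(b)-L_A(b)\otimes\mathrm{id})\Delta(a))$. Differential ASI bialgebra $(A,\cdot,\Delta,\Phi=\{\partial_k\},\Psi=\{\eth_k\})$: $(A,\cdot,\Delta)$ is an ASI bialgebra; $(A,\cdot,\Phi)$ is a $\Psi$-admissible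 differential algebra; the $\eth_k$ are commuting with $\Delta\eth_k=(\eth_k\otimes\mathrm{id}+\mathrm{id}\otimes\eth_k)\Delta$; and $(\partial_k\otimes\mathrm{id})\Delta=(\mathrm{id}\otimes\eth_k)\Delta+\Delta\partial_k$, $(\mathrm{id}\otimes\partial_k)\Delta=(\eth_k\otimes\mathrm{id})\Delta+\Delta\partial_k$. *)

(* Defs.v *)
From HB Require Import structures.
From mathcomp Require Import all_boot all_order all_algebra.

Set Implicit Arguments.
Unset Strict Implicit.
Unset Printing Implicit Defensive.

Import GRing.Theory.
Local Open Scope ring_scope.

(* [linfun f] is f itself only when f is linear, so each use of [linfun] below
   comes with a lemma checking that no junk value is involved.            *)

Lemma linfun_id (F : fieldType) (U V : vectType F) (f : U -> V) : linear f -> linfun f =1 f.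
Proof.
move=> fl x; pose L := GRing.isLinear.Build F U V *:%R f fl.
exact: (lfunE (HB.pack_for {linear U -> V} f L)).
Qed.

Section Multilinear.
Variables (F : fieldType) (U V W : vectType F).

Definition bilinear_map (f : U -> V -> W) : Prop :=
  (forall u, linear (f u)) /\ (forall v, linear (f^~ v)).

Definition bilfun (f : U -> V -> W) : 'Hom(U, 'Hom(V, W)) :=
  linfun (fun u => linfun (f u)).

Lemma bilfunE f : bilinear_map f -> forall u v, bilfun f u v = f u v.
Proof.
move=> [fr fl] u v; rewrite /bilfun linfun_id ?linfun_id //.
move=> a x y; apply/lfunP => z.
by rewrite add_lfunE scale_lfunE !linfun_id // fl.
Qed.

Lemma bilinear_hom2 (f : 'Hom(U, 'Hom(V, W))) : bilinear_map (fun u v => f u v).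
Proof.
split=> [u a x y | v a x y]; rewrite linearP //.
by rewrite add_lfunE scale_lfunE.
Qed.

End Multilinear.

Section Dual.
Variable F : fieldType.
Implicit Types A U V W : vectType F.

Definition dual V : vectType F := 'Hom(V, F^o).

Definition transpose U V (f : 'Hom(U, V)) : 'Hom(dual V, dual U) :=
  linfun (fun phi : dual V => (phi \o f)%VF).

Lemma transposeE U V (f : 'Hom(U, V)) (phi : dual V) u :
  transpose f phi u = phi (f u).
Proof.
rewrite /transpose linfun_id ?comp_lfunE // => a x y.
by rewrite comp_lfunDl comp_lfunZl.
Qed.

Definition dual_map A V (f : 'Hom(A, 'End(V))) : 'Hom(A, 'End(dual V)) :=
  linfun (fun a => transpose (f a)).

Lemma dual_mapE A V (f : 'Hom(A, 'End(V))) a : dual_map f a = transpose (f a).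
Proof.
rewrite /dual_map linfun_id // => c x y; apply/lfunP => phi; apply/lfunP => v.
rewrite !(add_lfunE, scale_lfunE) !transposeE linearP !(add_lfunE, scale_lfunE).
by rewrite linearP.
Qed.

Definition dual_vbasis V (i : 'I_(\dim {:V})) : dual V :=
  linfun (coord (vbasis {:V}) i : V -> F^o).

Lemma dual_vbasisE V i (v : V) : dual_vbasis i v = coord (vbasis {:V}) i v.
Proof. by rewrite linfun_id // => a x y; rewrite linearP. Qed.

End Dual.

(* Tensor product of finite-dimensional spaces: U (x) V is realised as
   Hom(U^*, V), the pure tensor u (x) v being phi |-> phi(u) v.  The lemmas
   [tliftE] and [tlift_unique] are its universal property.                    *)
Section Tensor.
Variable F : fieldType.
Implicit Types A U V W : vectType F.

Definition tensor U V : vectType F := 'Hom(dual U, V).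

Definition pure U V (u : U) (v : V) : tensor U V :=
  linfun (fun phi : dual U => (phi u : F) *: v).

Lemma pureE U V (u : U) (v : V) (phi : dual U) : pure u v phi = (phi u : F) *: v.
Proof.
rewrite /pure linfun_id // => a x y.
by rewrite add_lfunE scale_lfunE scalerDl -scalerA.
Qed.

Lemma pure_bilinear U V : bilinear_map (@pure U V).
Proof.
split=> [u a x y | v a x y]; apply/lfunP => phi;
  rewrite add_lfunE scale_lfunE !pureE.
  by rewrite scalerDr !scalerA mulrC.
by rewrite linearP scalerDl -scalerA.
Qed.

Lemma tensor_decomp U V (s : tensor U V) :
  s = \sum_(i < \dim {:U}) pure (vbasis {:U})`_i (s (dual_vbasis i)).
Proof.
apply/lfunP => phi; rewrite sum_lfunE.
have {1}-> : phi = \sum_(i < \dim {:U}) (phi (vbasis {:U})`_i : F) *: dual_vbasis i.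
  apply/lfunP => u; rewrite sum_lfunE {1}(coord_vbasis (memvf u)) linear_sum.
  apply: eq_bigr => i _; rewrite linearZ scale_lfunE dual_vbasisE.
  by rewrite /GRing.scale /= mulrC.
rewrite linear_sum; apply: eq_bigr => i _.
by rewrite linearZ pureE.
Qed.

(* The linear map U (x) V -> W induced by a bilinear map. *)
Definition tlift U V W (f : U -> V -> W) : 'Hom(tensor U V, W) :=
  linfun (fun s : tensor U V =>
    \sum_(i < \dim {:U}) f (vbasis {:U})`_i (s (dual_vbasis i))).

Lemma tliftE U V W (f : U -> V -> W) :
  bilinear_map f -> forall u v, tlift f (pure u v) = f u v.
Proof.
move=> bf u v; have [fr fl] := bf; rewrite /tlift linfun_id => [|a x y].
  rewrite -[RHS](bilfunE bf) [in RHS](coord_vbasis (memvf u)) linear_sum.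
  rewrite sum_lfunE; apply: eq_bigr => i _.
  rewrite pureE dual_vbasisE linearZ scale_lfunE -!(bilfunE bf).
  exact: linearZ.
rewrite scaler_sumr -big_split /=; apply: eq_bigr => i _.
by rewrite add_lfunE scale_lfunE fr.
Qed.

Lemma tlift_unique U V W (f g : 'Hom(tensor U V, W)) :
  (forall u v, f (pure u v) = g (pure u v)) -> f = g.
Proof.
move=> fg; apply/lfunP => s; rewrite (tensor_decomp s) !linear_sum.
by apply: eq_bigr => i _; apply: fg.
Qed.

Definition tmap (U V U' V' : vectType F) (f : 'Hom(U, U')) (g : 'Hom(V, V')) :
    'Hom(tensor U V, tensor U' V') :=
  tlift (fun u v => pure (f u) (g v)).

Lemma tmapE (U V U' V' : vectType F) (f : 'Hom(U, U')) (g : 'Hom(V, V')) u v :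
  tmap f g (pure u v) = pure (f u) (g v).
Proof.
have [pr pl] := @pure_bilinear U' V'; rewrite /tmap tliftE //.
by split=> [x a y z | x a y z]; rewrite linearP ?pr ?pl.
Qed.

Definition flip U V : 'Hom(tensor U V, tensor V U) :=
  tlift (fun u v => pure v u).

Lemma flipE U V (u : U) (v : V) : flip U V (pure u v) = pure v u.
Proof.
by have [pr pl] := @pure_bilinear V U; rewrite /flip tliftE.
Qed.

Definition tassoc U V W :
    'Hom(tensor (tensor U V) W, tensor U (tensor V W)) :=
  tlift (fun uv w => tlift (fun u v => pure u (pure v w)) uv).

Lemma tassocE U V W (u : U) (v : V) (w : W) :
  tassoc U V W (pure (pure u v) w) = pure u (pure v w).
Proof.
have [pr pl] := @pure_bilinear U (tensor V W).
have [qr ql] := @pure_bilinear V W.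
have b0 w' : bilinear_map (fun u' v' => pure u' (pure v' w') : tensor U (tensor V W)).
  by split=> [x a y z | x a y z]; [rewrite ql pr | rewrite pl].
rewrite /tassoc tliftE ?tliftE //; split=> [x a y z | x a y z]; last first.
  by rewrite linearP.
set f := tlift _; set g := tlift _; set h := tlift _.
have -> : f = a *: g + h.
  apply: tlift_unique => u' v'; rewrite add_lfunE scale_lfunE !tliftE //.
  by rewrite qr pr.
by rewrite add_lfunE scale_lfunE.
Qed.

End Tensor.

(* An algebra is a space A with a product mu : A -> End(A), so that
   [mu a b] is a . b and mu itself is L_A.                                    *)
Section DifferentialAlgebra.
Variable F : fieldType.
Implicit Types A V : vectType F.

Definition rmul A (mu : 'Hom(A, 'End(A))) : 'Hom(A, 'End(A)) :=
  bilfun (fun b a => mu a b).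

Lemma rmulE A (mu : 'Hom(A, 'End(A))) a b : rmul mu b a = mu a b.
Proof.
have [br bl] := bilinear_hom2 mu.
by rewrite /rmul bilfunE //; split=> x c y z; rewrite ?br ?bl.
Qed.

Definition is_algebra A (mu : 'Hom(A, 'End(A))) : Prop :=
  forall a b c, mu (mu a b) c = mu a (mu b c).

Definition commuting m V (f : 'I_m -> 'End(V)) : Prop :=
  forall i j, (f i \o f j)%VF = (f j \o f i)%VF.

Definition derivation A (mu : 'Hom(A, 'End(A))) (d : 'End(A)) : Prop :=
  forall a b, d (mu a b) = mu (d a) b + mu a (d b).

Definition diff_algebra A m (mu : 'Hom(A, 'End(A))) (Phi : 'I_m -> 'End(A)) :
    Prop :=
  [/\ is_algebra mu, forall k, derivation mu (Phi k) & commuting Phi].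

Definition bimodule A V (mu : 'Hom(A, 'End(A))) (l r : 'Hom(A, 'End(V))) :
    Prop :=
  [/\ forall a b v, l a (l b v) = l (mu a b) v,
      forall a b v, r b (r a v) = r (mu a b) v &
      forall a b v, r b (l a v) = l a (r b v)].

Definition diff_bimodule A V m (mu : 'Hom(A, 'End(A))) (Phi : 'I_m -> 'End(A))
    (l r : 'Hom(A, 'End(V))) (Omega : 'I_m -> 'End(V)) : Prop :=
  [/\ bimodule mu l r, commuting Omega,
      forall k a v, Omega k (l a v) = l (Phi k a) v + l a (Omega k v) &
      forall k a v, Omega k (r a v) = r (Phi k a) v + r a (Omega k v)].

Definition dual_fam m V (f : 'I_m -> 'End(V)) : 'I_m -> 'End(dual V) :=
  fun k => transpose (f k).

Definition admissible A V m (mu : 'Hom(A, 'End(A))) (Phi : 'I_m -> 'End(A))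
    (l r : 'Hom(A, 'End(V))) (Pi : 'I_m -> 'End(V)) : Prop :=
  commuting Pi /\
  diff_bimodule mu Phi (dual_map r) (dual_map l) (dual_fam Pi).

Definition self_admissible A m (mu : 'Hom(A, 'End(A)))
    (Phi Psi : 'I_m -> 'End(A)) : Prop :=
  admissible mu Phi mu (rmul mu) Psi.

Definition semidirect A V (mu : 'Hom(A, 'End(A))) (l r : 'Hom(A, 'End(V))) :
    'Hom((A * V)%type, 'End((A * V)%type)) :=
  bilfun (fun x y : A * V => (mu x.1 y.1, l x.1 y.2 + r y.1 x.2)).

Lemma semidirectE A V (mu : 'Hom(A, 'End(A))) (l r : 'Hom(A, 'End(V))) x y :
  semidirect mu l r x y = (mu x.1 y.1, l x.1 y.2 + r y.1 x.2).
Proof.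
rewrite /semidirect bilfunE //; split=> [z a u v | z a u v] /=.
  congr pair; rewrite !linearP //= add_lfunE scale_lfunE scalerDr.
  by rewrite !addrA; congr (_ + _); rewrite addrAC.
congr pair; rewrite !linearP //= !(add_lfunE, scale_lfunE) //.
by rewrite scalerDr !addrA; congr (_ + _); rewrite addrAC.
Qed.

Definition sum_fam m (V1 V2 : vectType F) (f : 'I_m -> 'End(V1)) (g : 'I_m -> 'End(V2)) :
    'I_m -> 'End((V1 * V2)%type) :=
  fun k => linfun (fun x : V1 * V2 => (f k x.1, g k x.2)).

Lemma sum_famE m (V1 V2 : vectType F) (f : 'I_m -> 'End(V1)) (g : 'I_m -> 'End(V2)) k x :
  sum_fam f g k x = (f k x.1, g k x.2).
Proof. by rewrite /sum_fam linfun_id // => a u v /=; rewrite !linearP. Qed.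

End DifferentialAlgebra.

Section OOperator.
Variables (F : fieldType) (A V : vectType F).

Definition O_operator (mu : 'Hom(A, 'End(A))) (l r : 'Hom(A, 'End(V)))
    (T : 'Hom(V, A)) : Prop :=
  forall u v, mu (T u) (T v) = T (l (T u) v + r (T v) u).

Definition diff_O_operator m (mu : 'Hom(A, 'End(A))) (Phi : 'I_m -> 'End(A))
    (l r : 'Hom(A, 'End(V))) (Omega : 'I_m -> 'End(V)) (T : 'Hom(V, A)) : Prop :=
  O_operator mu l r T /\ forall k, (Phi k \o T)%VF = (T \o Omega k)%VF.

Definition hom_tensor (T : 'Hom(V, A)) :
    tensor (A * dual V)%type (A * dual V)%type :=
  \sum_(i < \dim {:V})
    pure (T (vbasis {:V})`_i, 0 : dual V) (0 : A, dual_vbasis i).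

End OOperator.

Section Bialgebra.
Variables (F : fieldType) (A : vectType F) (mu : 'Hom(A, 'End(A))).

Definition antisymmetric_tensor (s : tensor A A) : Prop := s = - flip A A s.

(* For s = sum_i a_i (x) b_i, [tensor_sum2 f s] is
   sum_(i, j) f a_i b_i a_j b_j.                                              *)
Definition tensor_sum2 (W : vectType F) (f : A -> A -> A -> A -> W)
    (s : tensor A A) : W :=
  tlift (fun a b => tlift (fun a' b' => f a b a' b') s) s.

Definition s12s13 (s : tensor A A) : tensor A (tensor A A) :=
  tensor_sum2 (fun a b a' b' => pure (mu a a') (pure b b')) s.

Definition s13s23 (s : tensor A A) : tensor A (tensor A A) :=
  tensor_sum2 (fun a b a' b' => pure a (pure a' (mu b b'))) s.

Definition s23s12 (s : tensor A A) : tensor A (tensor A A) :=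
  tensor_sum2 (fun a b a' b' => pure a' (pure (mu a b') b)) s.

Definition admissible_AYBE m (Phi Psi : 'I_m -> 'End(A)) (s : tensor A A) :
    Prop :=
  [/\ s12s13 s + s13s23 s - s23s12 s = 0,
      forall k, (tmap (Phi k) \1%VF - tmap \1%VF (Psi k)) s = 0 &
      forall k, (tmap (Psi k) \1%VF - tmap \1%VF (Phi k)) s = 0].

Definition coassociative (Delta : 'Hom(A, tensor A A)) : Prop :=
  forall x, tassoc A A A (tmap Delta \1%VF (Delta x)) = tmap \1%VF Delta (Delta x).

Definition ASI_bialgebra (Delta : 'Hom(A, tensor A A)) : Prop :=
  [/\ is_algebra mu, coassociative Delta,
      forall a b, Delta (mu a b) =
        tmap (rmul mu b) \1%VF (Delta a) + tmap \1%VF (mu a) (Delta b) &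
      forall a b, (tmap (mu a) \1%VF - tmap \1%VF (rmul mu a)) (Delta b) =
        flip A A ((tmap \1%VF (rmul mu b) - tmap (mu b) \1%VF) (Delta a))].

Definition diff_ASI_bialgebra m (Delta : 'Hom(A, tensor A A))
    (Phi Psi : 'I_m -> 'End(A)) : Prop :=
  [/\ ASI_bialgebra Delta,
      diff_algebra mu Phi /\ self_admissible mu Phi Psi,
      commuting Psi /\
      forall k x, Delta (Psi k x) =
        (tmap (Psi k) \1%VF + tmap \1%VF (Psi k)) (Delta x),
      forall k x, tmap (Phi k) \1%VF (Delta x) =
        tmap \1%VF (Psi k) (Delta x) + Delta (Phi k x) &
      forall k x, tmap \1%VF (Phi k) (Delta x) =
        tmap (Psi k) \1%VF (Delta x) + Delta (Phi k x)].

Definition coboundary (s : tensor A A) : 'Hom(A, tensor A A) :=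
  linfun (fun x => (tmap \1%VF (mu x) - tmap (rmul mu x) \1%VF) s).

End Bialgebra.

Section SanityChecks.
Variable F : fieldType.

Lemma tmap_linear_r (U V V' U' : vectType F) (f : 'Hom(U, U')) :
  linear (fun g : 'Hom(V, V') => tmap f g).
Proof.
move=> a g h; apply: tlift_unique => u v.
rewrite add_lfunE scale_lfunE !tmapE add_lfunE scale_lfunE.
by have [-> _] := @pure_bilinear F U' V'.
Qed.

Lemma tmap_linear_l (U V V' U' : vectType F) (g : 'Hom(V, V')) :
  linear (fun f : 'Hom(U, U') => tmap f g).
Proof.
move=> a f h; apply: tlift_unique => u v.
rewrite add_lfunE scale_lfunE !tmapE add_lfunE scale_lfunE.
by have [_ ->] := @pure_bilinear F U' V'.
Qed.

Lemma coboundaryE (A : vectType F) (mu : 'Hom(A, 'End(A))) s x :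
  coboundary mu s x = (tmap \1%VF (mu x) - tmap (rmul mu x) \1%VF) s.
Proof.
rewrite /coboundary linfun_id // => a y z.
rewrite !linearP tmap_linear_r tmap_linear_l.
rewrite !(add_lfunE, opp_lfunE, scale_lfunE) !opprD scalerDr scalerN.
by rewrite addrACA.
Qed.

Lemma tensor_sum2E (A W : vectType F) (f : A -> A -> A -> A -> W) n
    (a b : 'I_n -> A) :
  (forall x y, bilinear_map (f x y)) ->
  (forall x' y', bilinear_map (fun x y => f x y x' y')) ->
  tensor_sum2 f (\sum_(i < n) pure (a i) (b i)) =
    \sum_(i < n) \sum_(j < n) f (a i) (b i) (a j) (b j).
Proof.
move=> bf bf'; pose s : tensor A A := \sum_(i < n) pure (a i) (b i).
rewrite /tensor_sum2 -/s.
have tl x y : tlift (f x y) s = \sum_(j < n) f x y (a j) (b j).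
  by rewrite linear_sum; apply: eq_bigr => j _ /=; rewrite tliftE.
rewrite [LHS]linear_sum; apply: eq_bigr => i _ /=; rewrite tliftE ?tl //.
split=> [x c y z | y c x z]; rewrite !tl scaler_sumr -big_split /=;
  apply: eq_bigr => j _; have [fr fl] := bf' (a j) (b j).
  exact: fr.
exact: fl.
Qed.

Section Products.
Variables (A : vectType F) (mu : 'Hom(A, 'End(A))) (n : nat) (a b : 'I_n -> A).
Let s : tensor A A := \sum_(i < n) pure (a i) (b i).
Let pr U V := (@pure_bilinear F U V).1.
Let pl U V := (@pure_bilinear F U V).2.
Let mr := (bilinear_hom2 mu).1.
Let ml := (bilinear_hom2 mu).2.

Lemma s12s13E : s12s13 mu s =
  \sum_(i < n) \sum_(j < n) pure (mu (a i) (a j)) (pure (b i) (b j)).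
Proof.
apply: tensor_sum2E => x y; split=> z c u v;
  by rewrite ?mr ?ml ?pr ?pl ?pr.
Qed.

Lemma s13s23E : s13s23 mu s =
  \sum_(i < n) \sum_(j < n) pure (a i) (pure (a j) (mu (b i) (b j))).
Proof.
apply: tensor_sum2E => x y; split=> z c u v;
  by rewrite ?mr ?ml ?pr ?pl ?pr.
Qed.

Lemma s23s12E : s23s12 mu s =
  \sum_(i < n) \sum_(j < n) pure (a j) (pure (mu (a i) (b j)) (b i)).
Proof.
apply: tensor_sum2E => x y; split=> z c u v;
  by rewrite ?mr ?ml ?pr ?pl ?pr.
Qed.

End Products.

Lemma hom_tensor_basis (A V : vectType F) (T : 'Hom(V, A)) n (e : n.-tuple V) :
  basis_of {:V} e ->
  hom_tensor T = \sum_(i < n)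
    pure (T e`_i, 0 : dual V) (0 : A, linfun (coord e i : V -> F^o) : dual V).
Proof.
suff key p (b : p.-tuple V) : basis_of {:V} b ->
    forall phi : dual (A * dual V)%type,
    (\sum_(i < p) pure (T b`_i, 0 : dual V)
      (0 : A, linfun (coord b i : V -> F^o) : dual V)) phi =
    (0, linfun (fun v => phi (T v, 0) : F^o)).
  move=> eb; apply/lfunP => phi; rewrite (key n e eb phi).
  exact: (key _ _ (vbasisP _) phi).
move=> bb phi; rewrite sum_lfunE.
under eq_bigr do rewrite pureE.
set S := \sum_(i < p) _.
have S1 : S.1 = 0.
  rewrite /S (raddf_sum (@fst A (dual V))) big1 // => i _ /=.
  by rewrite scaler0.
suff S2 : S.2 = linfun (fun v => phi (T v, 0) : F^o).
  by rewrite (surjective_pairing S) S1 S2.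
rewrite /S (raddf_sum (@snd A (dual V))) /=; apply/lfunP => v.
have lin : linear (fun v => phi (T v, 0) : F^o).
  move=> c x y; rewrite -[RHS]linearP; congr (phi _).
  by congr pair; [exact: linearP | rewrite /= scaler0 addr0].
rewrite sum_lfunE [in RHS](coord_basis bb (memvf v)).
rewrite [RHS]linear_sum; apply: eq_bigr => i _ /=.
rewrite scale_lfunE linfun_id => [|c x y]; last by rewrite linearP.
rewrite [RHS]linearZ [X in _ = _ *: X](linfun_id lin).
exact: mulrC.
Qed.

End SanityChecks.

(* Main.v *)
Require Import Defs.
From mathcomp Require Import all_boot all_order all_algebra.

Set Implicit Arguments.
Unset Strict Implicit.
Unset Printing Implicit Defensive.

Import GRing.Theory.
Local Open Scope ring_scope.

(** The whole proof reads an element [s] of [B (x) B] as the linear map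
    [phi |-> (phi (x) id)(s)] from [dual B] to [B].  Under this reading each
    tensor identity becomes an identity between maps on dual vectors:
    [f (x) g] acts by [t |-> g o t o f^*], the flip is transposition, and an
    antisymmetric [s] is one with [phi (s psi) = - psi (s phi)].

    For antisymmetric [s] the AYBE then says
    [s phi . s psi = s (R^*(s phi) psi + L^*(s psi) phi)], i.e. [s] is an
    O-operator associated to [dual B] with the coadjoint actions [R^*] and [L^*]
    ([AYBE_O_operator]), and the two differential conditions say that [s]
    intertwines [Phi^*] with [Psi] and [Psi^*] with [Phi]
    ([tensor_intertwines]).

    The coboundary [Delta x = (id (x) L(x) - R(x) (x) id) s] becomes
    [Delta x phi = x . s phi - s (R(x)^* phi)].  The product on [dual B] that it
    induces is [phi o psi = R^*(s phi) psi + L^*(s psi) phi], and [s] is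
    multiplicative for it by the AYBE; this gives coassociativity.  The
    compatibilities of [Delta] with the product come from associativity and
    antisymmetry, those with the derivations from admissibility and the
    Leibniz rule combined with the intertwining relations ([coboundary_diff_ASI_bialgebra]).

    On [B = A (+) dual V] a functional amounts to a pair [(f, v)] in
    [dual A (+) V], and the map of [T - sigma T] is [(f, v) |-> (- T v, f o T)].
    The O-operator identity for this map has first component
    [T v . T w = T (l (T v) w + r (T w) v)]; its second component is a
    consequence of the first ([O_operator_skew]).  Likewise each of the two
    intertwining relations splits into [Phi T = T Omega] and [T Pi = Psi T]
    ([skew_intertwines]). *)

(** * Bimodules and their duals *)

Lemma adjoint_bimodule (F : fieldType) (A : vectType F)
    (mu : 'Hom(A, 'End(A))) :
  is_algebra mu -> bimodule mu mu (rmul mu).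
Proof. by move=> assoc; split=> a b v; rewrite ?rmulE assoc. Qed.

Lemma bimodule_dual (F : fieldType) (A V : vectType F)
    (mu : 'Hom(A, 'End(A))) (l r : 'Hom(A, 'End(V))) :
  bimodule mu l r -> bimodule mu (dual_map r) (dual_map l).
Proof.
by move=> [ll rr lr]; split=> a b phi; apply/lfunP => v;
  rewrite !dual_mapE !transposeE ?ll ?rr ?lr.
Qed.

Lemma commuting_dual_fam (F : fieldType) (V : vectType F) m
    (g : 'I_m -> 'End(V)) :
  commuting g -> commuting (dual_fam g).
Proof.
move=> cg i j; apply/lfunP => phi; apply/lfunP => v.
by rewrite !comp_lfunE !transposeE -!comp_lfunE cg.
Qed.

(** Vectors of a finite-dimensional space may be compared by evaluating
    functionals; this is what turns identities on dual spaces back into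
    identities on the spaces themselves. *)
Lemma dual_separates (F : fieldType) (V : vectType F) (u v : V) :
  (forall phi : dual V, phi u = phi v) -> u = v.
Proof.
move=> uv; rewrite (coord_vbasis (memvf u)) (coord_vbasis (memvf v)).
by apply: eq_bigr => i _; have := uv (dual_vbasis i); rewrite !dual_vbasisE => ->.
Qed.

(** Admissibility is defined on the dual module; transposing the defining
    identities gives conditions on [V], which is the form used in
    computations. *)
Lemma admissibleP (F : fieldType) (A V : vectType F) m (mu : 'Hom(A, 'End(A)))
    (Phi : 'I_m -> 'End(A)) (l r : 'Hom(A, 'End(V))) (Pi : 'I_m -> 'End(V)) :
  bimodule mu l r ->
  admissible mu Phi l r Pi <->
  [/\ commuting Pi,
      forall k a v, r a (Pi k v) = r (Phi k a) v + Pi k (r a v) &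
      forall k a v, l a (Pi k v) = l (Phi k a) v + Pi k (l a v)].
Proof.
move=> bim; split=> [[cPi [_ _ Dr Dl]] | [cPi Dr Dl]].
  split=> // k a v; apply: dual_separates => xi; rewrite linearD /=.
    have /lfunP/(_ v) := Dr k a xi.
    by rewrite add_lfunE !dual_mapE !transposeE.
  have /lfunP/(_ v) := Dl k a xi.
  by rewrite add_lfunE !dual_mapE !transposeE.
split=> //; split; [exact: bimodule_dual | exact: commuting_dual_fam | |].
  move=> k a phi; apply/lfunP => v.
  by rewrite add_lfunE !dual_mapE !transposeE Dr linearD.
move=> k a phi; apply/lfunP => v.
by rewrite add_lfunE !dual_mapE !transposeE Dl linearD.
Qed.

Lemma self_admissibleP (F : fieldType) (A : vectType F) m
    (mu : 'Hom(A, 'End(A))) (Phi Psi : 'I_m -> 'End(A)) :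
  is_algebra mu ->
  self_admissible mu Phi Psi <->
  [/\ commuting Psi,
      forall k a b, mu (Psi k a) b = mu a (Phi k b) + Psi k (mu a b) &
      forall k a b, mu a (Psi k b) = mu (Phi k a) b + Psi k (mu a b)].
Proof.
move=> /adjoint_bimodule bim.
apply: (iff_trans (admissibleP Phi Psi bim)).
by split=> -[cPsi Hr Hl]; split=> // k a b; have := Hr k b a; rewrite !rmulE.
Qed.

(** * Tensors as linear maps on the dual *)

Section TensorsAsMaps.
Variable F : fieldType.
Implicit Types U V W : vectType F.

Lemma lfunZ U V (f : 'Hom(U, V)) c u : f (c *: u) = c *: f u.
Proof. exact: linearZ. Qed.

Lemma dualZ V (phi : dual V) c v : phi (c *: v) = c * phi v :> F.
Proof. by rewrite linearZ. Qed.

Lemma tmap_hom U V U' V' (f : 'Hom(U, U')) (g : 'Hom(V, V')) (t : tensor U V)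
    (phi : dual U') : tmap f g t phi = g (t (transpose f phi)).
Proof.
rewrite (tensor_decomp t) linear_sum !sum_lfunE linear_sum.
apply: eq_bigr => i _; rewrite /= tmapE !pureE transposeE.
by rewrite linearZ.
Qed.

Lemma tmap_l_hom U U' V (f : 'Hom(U, U')) (t : tensor U V) (phi : dual U') :
  tmap f \1%VF t phi = t (transpose f phi).
Proof. by rewrite tmap_hom id_lfunE. Qed.

Lemma tmap_r_hom U V V' (g : 'Hom(V, V')) (t : tensor U V) (phi : dual U) :
  tmap \1%VF g t phi = g (t phi).
Proof.
rewrite tmap_hom; congr (g (t _)).
by apply/lfunP => y; rewrite transposeE id_lfunE.
Qed.

Lemma flip_pairing U V (t : tensor U V) (phi : dual U) (psi : dual V) :
  phi (flip U V t psi) = psi (t phi).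
Proof.
rewrite (tensor_decomp t) linear_sum !sum_lfunE !linear_sum.
apply: eq_bigr => i _; rewrite /= flipE !pureE !linearZ.
exact: mulrC.
Qed.

Lemma flipK U V (t : tensor U V) : flip V U (flip U V t) = t.
Proof.
apply/lfunP => phi; apply: dual_separates => psi.
by rewrite !flip_pairing.
Qed.

Lemma tensor_apply U V (t : tensor U V) (phi : dual U) :
  t phi = \sum_(i < \dim {:U}) (phi (vbasis {:U})`_i : F) *: t (dual_vbasis i).
Proof.
by rewrite {1}(tensor_decomp t) sum_lfunE; apply: eq_bigr => i _; rewrite pureE.
Qed.

Lemma flip_apply U V (t : tensor U V) (psi : dual V) :
  flip U V t psi = \sum_(i < \dim {:U}) (psi (t (dual_vbasis i)) : F) *: (vbasis {:U})`_i.
Proof.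
rewrite {1}(tensor_decomp t) linear_sum sum_lfunE.
by apply: eq_bigr => i _; rewrite /= flipE pureE.
Qed.

(** The image of [phi (x) psi] under the canonical map from
    [dual U (x) dual V] to the dual of [U (x) V]. *)
Definition pure_functional U V (phi : dual U) (psi : dual V) : dual (tensor U V) :=
  linfun (fun t : tensor U V => psi (t phi)).

Lemma pure_functionalE U V (phi : dual U) (psi : dual V) t :
  pure_functional phi psi t = psi (t phi).
Proof.
by rewrite /pure_functional linfun_id // => a x y; rewrite add_lfunE scale_lfunE linearP.
Qed.

Lemma tassoc_hom U V W (t : tensor (tensor U V) W) (phi : dual U) (psi : dual V) :
  tassoc U V W t phi psi = t (pure_functional phi psi).
Proof.
rewrite (tensor_apply t (pure_functional phi psi)).
rewrite {1}(tensor_decomp t) linear_sum !sum_lfunE.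
apply: eq_bigr => i _; rewrite pure_functionalE.
move: (vbasis _)`_i (t _) => w c.
rewrite (tensor_decomp w) !sum_lfunE linear_sum.
have [pr pl] := @pure_bilinear F (tensor U V) W.
have -> : pure (\sum_(j < \dim {:U}) pure (vbasis {:U})`_j (w (dual_vbasis j))) c =
   \sum_(j < \dim {:U}) pure (pure (vbasis {:U})`_j (w (dual_vbasis j))) c.
  apply/lfunP => h; rewrite pureE sum_lfunE linear_sum scaler_suml.
  by apply: eq_bigr => j _; rewrite pureE.
rewrite linear_sum !sum_lfunE scaler_suml; apply: eq_bigr => j _ /=.
by rewrite tassocE !pureE scale_lfunE pureE dualZ scalerA.
Qed.

End TensorsAsMaps.

(** * The associative Yang-Baxter equation as an O-operator identity *)

Section YangBaxter.
Variables (F : fieldType) (B : vectType F) (mu : 'Hom(B, 'End(B))).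
Implicit Types (s : tensor B B) (phi psi : dual B).

Lemma s12s13_hom s phi psi :
  s12s13 mu s phi psi = s (transpose (mu (flip B B s psi)) phi).
Proof.
rewrite {1}(tensor_decomp s) s12s13E !sum_lfunE [RHS]tensor_apply.
under eq_bigr do rewrite !sum_lfunE.
rewrite exchange_big /=; apply: eq_bigr => j _.
rewrite transposeE flip_apply linear_sum sum_lfunE linear_sum scaler_suml.
apply: eq_bigr => i _ /=.
rewrite !pureE scale_lfunE pureE lfunZ scale_lfunE.
by rewrite dualZ scalerA mulrC.
Qed.

Lemma s13s23_hom s phi psi : s13s23 mu s phi psi = mu (s phi) (s psi).
Proof.
rewrite {1}(tensor_decomp s) s13s23E !sum_lfunE.
rewrite (tensor_apply s phi) linear_sum sum_lfunE.
apply: eq_bigr => i _; rewrite (tensor_apply s psi) linear_sum !sum_lfunE.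
apply: eq_bigr => j _; rewrite !pureE /= scale_lfunE pureE !lfunZ scale_lfunE.
by rewrite !scalerA mulrC.
Qed.

Lemma s23s12_hom s phi psi :
  s23s12 mu s phi psi = s (transpose (rmul mu (s phi)) psi).
Proof.
rewrite {1}(tensor_decomp s) s23s12E !sum_lfunE [RHS]tensor_apply.
apply: eq_bigr => i _; rewrite !sum_lfunE transposeE rmulE.
rewrite (tensor_apply s phi) !linear_sum scaler_suml; apply: eq_bigr => j _ /=.
by rewrite !pureE scale_lfunE pureE lfunZ dualZ scalerA.
Qed.

Lemma antisymmetric_skew s : antisymmetric_tensor (s - flip B B s).
Proof. by rewrite /antisymmetric_tensor linearB /= flipK opprB. Qed.

Lemma antisymmetric_pairing s : antisymmetric_tensor s ->
  forall phi psi, phi (s psi) = - psi (s phi) :> F.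
Proof. by move=> as_s phi psi; rewrite {1}as_s opp_lfunE linearN /= flip_pairing. Qed.

(** Evaluating the three terms on [phi] and [psi] gives
    [- s (L^*(s psi) phi)], [s phi . s psi] and [s (R^*(s phi) psi)]; the sign of
    the first one is where antisymmetry enters. *)
Lemma AYBE_O_operator s : antisymmetric_tensor s ->
  s12s13 mu s + s13s23 mu s - s23s12 mu s = 0 <->
  O_operator mu (dual_map (rmul mu)) (dual_map mu) s.
Proof.
move=> as_s.
have key phi psi : (s12s13 mu s + s13s23 mu s - s23s12 mu s) phi psi =
    mu (s phi) (s psi) -
    s (dual_map (rmul mu) (s phi) psi + dual_map mu (s psi) phi).
  rewrite !(add_lfunE, opp_lfunE) s12s13_hom s13s23_hom s23s12_hom !dual_mapE.
  have -> : flip B B s psi = - s psi.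
    by rewrite {2}as_s opp_lfunE opprK.
  have -> : transpose (mu (- s psi)) phi = - transpose (mu (s psi)) phi.
    by apply/lfunP => x; rewrite opp_lfunE !transposeE linearN opp_lfunE linearN.
  by rewrite linearN linearD /= addrAC [RHS]addrC opprD
    [- _ - _ in RHS]addrC.
split=> [eq0 phi psi | Os].
  by apply: subr0_eq; rewrite -key eq0 !zero_lfunE.
apply/lfunP => phi; apply/lfunP => psi.
by rewrite key -Os subrr !zero_lfunE.
Qed.

Lemma tensor_intertwines m (f g : 'I_m -> 'End(B)) s :
  (forall k, (tmap (f k) \1%VF - tmap \1%VF (g k)) s = 0) <->
  (forall k phi, s (transpose (f k) phi) = g k (s phi)).
Proof.
split=> [E k phi | E k].
  have /lfunP/(_ phi) := E k.
  rewrite !(add_lfunE, opp_lfunE) tmap_l_hom tmap_r_hom zero_lfunE.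
  exact: subr0_eq.
apply/lfunP => phi; rewrite !(add_lfunE, opp_lfunE) tmap_l_hom tmap_r_hom zero_lfunE.
by rewrite E subrr.
Qed.

End YangBaxter.

(** * The bialgebra of an antisymmetric solution *)

Section Coboundary.
Variables (F : fieldType) (B : vectType F) (mu : 'Hom(B, 'End(B))).
Variable s : tensor B B.

Lemma coboundary_hom x (phi : dual B) :
  coboundary mu s x phi = mu x (s phi) - s (transpose (rmul mu x) phi).
Proof.
by rewrite coboundaryE !(add_lfunE, opp_lfunE) tmap_l_hom tmap_r_hom.
Qed.

Hypotheses (assoc_mu : is_algebra mu) (antisym_s : antisymmetric_tensor s).

Lemma coboundary_mul a b : coboundary mu s (mu a b) =
  tmap (rmul mu b) \1%VF (coboundary mu s a)
  + tmap \1%VF (mu a) (coboundary mu s b).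
Proof.
apply/lfunP => phi; rewrite add_lfunE tmap_l_hom tmap_r_hom !coboundary_hom.
rewrite linearB /= assoc_mu [RHS]addrC addrA subrK.
congr (_ - s _); apply/lfunP => x.
by rewrite !transposeE !rmulE assoc_mu.
Qed.

(** Paired with [phi] and [psi], both sides consist of the same four numbers:
    exchanging the roles of [phi] and [psi] costs a sign in each. *)
Lemma coboundary_flip a b :
  (tmap (mu a) \1%VF - tmap \1%VF (rmul mu a)) (coboundary mu s b) =
  flip B B ((tmap \1%VF (rmul mu b) - tmap (mu b) \1%VF) (coboundary mu s a)).
Proof.
apply/lfunP => phi; apply: dual_separates => psi; rewrite flip_pairing.
rewrite !(add_lfunE, opp_lfunE) !tmap_l_hom !tmap_r_hom !coboundary_hom.
have pairL x y (xi : dual B) : xi (mu x y) = transpose (mu x) xi y.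
  by rewrite transposeE.
have pairR x y (xi : dual B) : xi (rmul mu x y) = transpose (rmul mu x) xi y.
  by rewrite transposeE.
rewrite !linearB /= !pairL !pairR !pairL.
(* Every term is now a pairing of [s] with translates of [phi] and [psi];
   antisymmetry moves [s] to the side of [phi] throughout. *)
rewrite !(antisymmetric_pairing antisym_s _ psi).
rewrite !(antisymmetric_pairing antisym_s _ (transpose _ psi)).
have -> : transpose (rmul mu b) (transpose (mu a) phi)
        = transpose (mu a) (transpose (rmul mu b) phi).
  by apply/lfunP => x; rewrite !transposeE !rmulE assoc_mu.
have -> : transpose (mu b) (transpose (rmul mu a) psi)
        = transpose (rmul mu a) (transpose (mu b) psi).
  by apply/lfunP => x; rewrite !transposeE !rmulE assoc_mu.
rewrite [phi _](antisymmetric_pairing antisym_s) !opprK [LHS]addrACA.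
exact: addrC.
Qed.

Hypothesis O_s : O_operator mu (dual_map (rmul mu)) (dual_map mu) s.

(** Coassociativity is associativity of the induced product on [dual B].  As [s]
    carries this product to that of [B], both sides reduce to
    [x . s phi . s psi] minus the value of [s] on one and the same functional. *)
Lemma coboundary_coassociative : coassociative (coboundary mu s).
Proof.
move=> x; apply/lfunP => phi; apply/lfunP => psi; rewrite tmap_r_hom.
(* [theta] is the product of [phi] and [psi] dual to the coboundary. *)
pose theta := dual_map (rmul mu) (s phi) psi + dual_map mu (s psi) phi.
have thetaE w : theta w = psi (coboundary mu s w phi).
  rewrite coboundary_hom linearB /= (antisymmetric_pairing antisym_s) opprK.
  by rewrite add_lfunE !dual_mapE !transposeE !rmulE.
rewrite tassoc_hom tmap_l_hom.
have -> : transpose (coboundary mu s) (pure_functional phi psi) = theta.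
  by apply/lfunP => w; rewrite transposeE pure_functionalE thetaE.
have s_theta : s theta = mu (s phi) (s psi) by rewrite O_s.
rewrite !coboundary_hom s_theta; set phi' := transpose (rmul mu x) phi.
(* What is left is the O-operator identity for [phi'] and [psi]. *)
rewrite [mu (_ - _)]linearB add_lfunE opp_lfunE assoc_mu (O_s phi' psi).
rewrite -addrA -opprD -linearD /=; congr (_ - s _); apply/lfunP => y.
rewrite !(add_lfunE, dual_mapE, transposeE, rmulE) !assoc_mu !linearB.
by rewrite /= [RHS]addrC addrA subrK.
Qed.

Lemma coboundary_ASI_bialgebra : ASI_bialgebra mu (coboundary mu s).
Proof.
split=> //; first exact: coboundary_coassociative.
  exact: coboundary_mul.
exact: coboundary_flip.
Qed.

End Coboundary.

(** Each differential compatibility compares values [x . s phi'] with each other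
    and values of [s] with each other: admissibility and the Leibniz rule
    rewrite the former, their transposes the latter, and the intertwining
    relations move [Phi] and [Psi] across [s]. *)
Lemma coboundary_diff_ASI_bialgebra (F : fieldType) (B : vectType F)
    (mu : 'Hom(B, 'End(B))) (m : nat) (Phi Psi : 'I_m -> 'End(B))
    (s : tensor B B) :
  diff_algebra mu Phi -> self_admissible mu Phi Psi ->
  antisymmetric_tensor s -> admissible_AYBE mu Phi Psi s ->
  diff_ASI_bialgebra mu (coboundary mu s) Phi Psi.
Proof.
move=> dB adm as_s [aybe /tensor_intertwines s_Phi /tensor_intertwines s_Psi].
have [assoc der _] := dB.
have [cPsi Psi_l Psi_r] := (self_admissibleP Phi Psi assoc).1 adm.
split=> //.
- exact: coboundary_ASI_bialgebra assoc as_s ((AYBE_O_operator _ as_s).1 aybe).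
- split=> // k x; apply/lfunP => phi.
  rewrite !add_lfunE tmap_l_hom tmap_r_hom !coboundary_hom.
  rewrite s_Psi Psi_l linearB /= -s_Phi addrACA -opprD -linearD.
  congr (_ - s _); apply/lfunP => y.
  by rewrite add_lfunE !transposeE !rmulE Psi_r addrC linearD.
- move=> k x; apply/lfunP => phi.
  rewrite add_lfunE tmap_l_hom tmap_r_hom !coboundary_hom.
  rewrite s_Phi Psi_r linearB /= -s_Phi addrACA -opprD -linearD.
  rewrite [X in X - _]addrC; congr (_ - s _); apply/lfunP => y.
  by rewrite add_lfunE !transposeE !rmulE der linearD.
move=> k x; apply/lfunP => phi.
rewrite add_lfunE tmap_l_hom tmap_r_hom !coboundary_hom.
rewrite linearB /= der -!s_Psi addrACA -opprD -linearD.
rewrite [X in X - _]addrC; congr (_ - s _); apply/lfunP => y.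
by rewrite add_lfunE !transposeE !rmulE Psi_l linearD addrC.
Qed.

(** * Functionals on the sum of a space and a dual space *)

Section DualSum.
Variables (F : fieldType) (A V : vectType F).
Implicit Types (phi : dual (A * dual V)%type).

Lemma dual_vbasis_expansion (xi : dual V) :
  xi = \sum_(i < \dim {:V}) (xi (vbasis {:V})`_i : F) *: dual_vbasis i.
Proof.
apply/lfunP => u; rewrite sum_lfunE {1}(coord_vbasis (memvf u)) linear_sum.
apply: eq_bigr => i _; rewrite linearZ scale_lfunE dual_vbasisE.
exact: mulrC.
Qed.

(** The inverse of the canonical isomorphism from [V] to its bidual. *)
Definition bidual_inv (L : dual (dual V)) : V :=
  \sum_(i < \dim {:V}) (L (dual_vbasis i) : F) *: (vbasis {:V})`_i.

Lemma bidual_invE (L : dual (dual V)) (xi : dual V) : xi (bidual_inv L) = L xi.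
Proof.
rewrite [in RHS](dual_vbasis_expansion xi) !linear_sum.
by apply: eq_bigr => i _; rewrite !linearZ; exact: mulrC.
Qed.

(** [dual_sum_l] and [dual_sum_r] are the two components of the identification of
    [dual (A (+) dual V)] with [dual A (+) V]; the second one passes through the
    bidual of [V]. *)
Definition dual_sum_l phi : dual A := linfun (fun a => phi (a, 0)).
Definition dual_sum_r phi : V :=
  bidual_inv (linfun (fun xi : dual V => phi (0, xi))).

Lemma dual_sum_lE phi a : dual_sum_l phi a = phi (a, 0).
Proof.
rewrite /dual_sum_l linfun_id // => c x y; rewrite -linearP; congr (phi _).
by congr pair; rewrite /= scaler0 addr0.
Qed.

Lemma dual_sum_rE phi (xi : dual V) : xi (dual_sum_r phi) = phi (0, xi).
Proof.
rewrite bidual_invE linfun_id // => c x y; rewrite -linearP; congr (phi _).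
by congr pair; rewrite /= scaler0 addr0.
Qed.

Lemma dual_sumE phi a (xi : dual V) :
  phi (a, xi) = dual_sum_l phi a + xi (dual_sum_r phi).
Proof.
rewrite dual_sum_lE dual_sum_rE -linearD; congr (phi _).
by congr pair; rewrite /= ?addr0 ?add0r.
Qed.

Lemma hom_tensor_apply (T : 'Hom(V, A)) phi :
  hom_tensor T phi = (0, transpose T (dual_sum_l phi)).
Proof.
rewrite sum_lfunE [LHS]surjective_pairing; congr pair.
  rewrite (raddf_sum (@fst A (dual V))) big1 // => i _.
  by rewrite pureE /= scaler0.
rewrite (raddf_sum (@snd A (dual V))) [RHS]dual_vbasis_expansion.
by apply: eq_bigr => i _; rewrite pureE transposeE dual_sum_lE.
Qed.

Lemma flip_hom_tensor_apply (T : 'Hom(V, A)) phi :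
  flip _ _ (hom_tensor T) phi = (T (dual_sum_r phi), 0).
Proof.
apply: dual_separates => psi; rewrite flip_pairing hom_tensor_apply.
by rewrite -dual_sum_rE transposeE dual_sum_lE.
Qed.

Lemma skew_hom_tensor_apply (T : 'Hom(V, A)) phi :
  (hom_tensor T - flip _ _ (hom_tensor T)) phi =
  (- T (dual_sum_r phi), transpose T (dual_sum_l phi)).
Proof.
rewrite add_lfunE opp_lfunE hom_tensor_apply flip_hom_tensor_apply.
by congr pair; rewrite /= ?sub0r ?subr0.
Qed.

Lemma dual_sum_surj (f : dual A) (v : V) :
  exists phi, dual_sum_l phi = f /\ dual_sum_r phi = v.
Proof.
pose phi : dual (A * dual V)%type :=
  linfun (fun x : A * dual V => f x.1 + x.2 v : F^o).
have phiE a (xi : dual V) : phi (a, xi) = f a + xi v.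
  rewrite /phi linfun_id // => c x y /=.
  by rewrite !linearP add_lfunE scale_lfunE scalerDr addrACA.
exists phi; split.
  by apply/lfunP => a; rewrite dual_sum_lE phiE zero_lfunE addr0.
by apply: dual_separates => xi; rewrite dual_sum_rE phiE linear0 add0r.
Qed.

End DualSum.

(** * Semidirect products *)

Section Semidirect.
Variables (F : fieldType) (A V : vectType F) (m : nat).
Variables (mu : 'Hom(A, 'End(A))) (l r : 'Hom(A, 'End(V))).

Lemma commuting_sum_fam (f : 'I_m -> 'End(A)) (g : 'I_m -> 'End(V)) :
  commuting f -> commuting g -> commuting (sum_fam f g).
Proof.
move=> cf cg i j; apply/lfunP => x; rewrite !comp_lfunE !sum_famE /=.
by rewrite -!comp_lfunE cf cg.
Qed.

Lemma semidirect_algebra :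
  is_algebra mu -> bimodule mu l r -> is_algebra (semidirect mu l r).
Proof.
move=> assoc [ll rr lr] x y z; rewrite !semidirectE /= assoc; congr pair.
by rewrite !linearD /= -ll rr lr addrA.
Qed.

Lemma semidirect_diff_algebra (Phi : 'I_m -> 'End(A)) (Omega : 'I_m -> 'End(V)) :
  diff_algebra mu Phi -> diff_bimodule mu Phi l r Omega ->
  diff_algebra (semidirect mu l r) (sum_fam Phi Omega).
Proof.
move=> [assoc der cPhi] [bim cOmega Dl Dr]; split.
- exact: semidirect_algebra.
- move=> k x y; rewrite !(semidirectE, sum_famE) /=.
  rewrite der linearD /= Dl Dr; congr pair.
  by rewrite [RHS]addrACA; congr (_ + _); exact: addrC.
exact: commuting_sum_fam.
Qed.

End Semidirect.

(** On the [A]-components this is admissibility of [Psi]; on the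
    [dual V]-components each identity separates into a hypothesis linking
    [Psi], [Omega] and [Pi], and the derivation rule of [Omega] on the other
    action. *)
Lemma semidirect_dual_admissible (F : fieldType) (A V : vectType F) (m : nat)
    (mu : 'Hom(A, 'End(A))) (Phi Psi : 'I_m -> 'End(A))
    (l r : 'Hom(A, 'End(V))) (Pi Omega : 'I_m -> 'End(V)) :
  is_algebra mu -> diff_bimodule mu Phi l r Omega ->
  self_admissible mu Phi Psi ->
  (forall k a v, l (Psi k a) v = l a (Omega k v) + Pi k (l a v)) ->
  (forall k a v, r (Psi k a) v = r a (Omega k v) + Pi k (r a v)) ->
  self_admissible (semidirect mu (dual_map r) (dual_map l))
    (sum_fam Phi (dual_fam Pi)) (sum_fam Psi (dual_fam Omega)).
Proof.
move=> assoc [bim cOmega Dl Dr] adm Hl Hr.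
have [cPsi Psi_l Psi_r] := (self_admissibleP Phi Psi assoc).1 adm.
apply/self_admissibleP.
  exact/semidirect_algebra/bimodule_dual.
split=> [|k x y|k x y].
- exact/commuting_sum_fam/commuting_dual_fam.
- rewrite !(semidirectE, sum_famE) /= Psi_l; congr pair.
  apply/lfunP => v; rewrite !(add_lfunE, dual_mapE, transposeE).
  rewrite Hr Dl !linearD /=.
  by rewrite [RHS]addrACA; congr (_ + _); exact: addrC.
rewrite !(semidirectE, sum_famE) /= Psi_r; congr pair.
apply/lfunP => v; rewrite !(add_lfunE, dual_mapE, transposeE).
rewrite Hl Dr !linearD /=.
by rewrite [RHS]addrACA; congr (_ + _); exact: addrC.
Qed.

(** * The tensor of a map T, skew-symmetrised *)

Section SkewHom.
Variables (F : fieldType) (A V : vectType F) (mu : 'Hom(A, 'End(A))).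
Variables (l r : 'Hom(A, 'End(V))) (T : 'Hom(V, A)).
Local Notation Ahat := (A * dual V)%type.
Local Notation muhat := (semidirect mu (dual_map r) (dual_map l)).
Local Notation s := (hom_tensor T - flip Ahat Ahat (hom_tensor T)).

(** The two components of the functional [R^*(s phi) psi + L^*(s psi) phi] that
    enters the O-operator identity for [s]. *)
Lemma coadjoint_dual_sum_r (phi psi : dual Ahat) :
  dual_sum_r (dual_map (rmul muhat) (s phi) psi + dual_map muhat (s psi) phi) =
  - (l (T (dual_sum_r phi)) (dual_sum_r psi)
     + r (T (dual_sum_r psi)) (dual_sum_r phi)).
Proof.
apply: dual_separates => xi; rewrite dual_sum_rE !skew_hom_tensor_apply.
rewrite add_lfunE !dual_mapE !transposeE rmulE !semidirectE /=.
rewrite !dual_sumE !dual_mapE !add_lfunE !transposeE.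
rewrite !(linear0, linearN, zero_lfunE, opp_lfunE) /=.
rewrite !(linear0, linearN, linearD, zero_lfunE, opp_lfunE) /=.
by rewrite !(add0r, addr0).
Qed.

Lemma coadjoint_dual_sum_l (phi psi : dual Ahat) a :
  dual_sum_l (dual_map (rmul muhat) (s phi) psi + dual_map muhat (s psi) phi) a =
  (- dual_sum_l psi (mu a (T (dual_sum_r phi)))
   + dual_sum_l phi (T (r a (dual_sum_r psi))))
  + (- dual_sum_l phi (mu (T (dual_sum_r psi)) a)
     + dual_sum_l psi (T (l a (dual_sum_r phi)))).
Proof.
rewrite dual_sum_lE !skew_hom_tensor_apply.
rewrite add_lfunE !dual_mapE !transposeE rmulE !semidirectE /=.
rewrite !dual_sumE !dual_mapE !add_lfunE !transposeE.
rewrite !(linear0, linearN, zero_lfunE, opp_lfunE) /=.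
by rewrite !(addr0, add0r).
Qed.

(** In the second component of the identity for [s] every product has the form
    [T u . T v]; expanding these by the O-operator identity for [T] makes the
    terms cancel in pairs. *)
Lemma O_operator_skew :
  O_operator muhat (dual_map (rmul muhat)) (dual_map muhat) s <->
  O_operator mu l r T.
Proof.
split=> [Os u v | OT phi psi].
  have [phi [_ phi_r]] := dual_sum_surj (0 : dual A) u.
  have [psi [_ psi_r]] := dual_sum_surj (0 : dual A) v.
  have /(congr1 (@fst A (dual V))) := Os phi psi.
  rewrite semidirectE [in RHS]skew_hom_tensor_apply coadjoint_dual_sum_r /=.
  rewrite !skew_hom_tensor_apply /= phi_r psi_r.
  by rewrite !linearN /= !(opp_lfunE, opprK).
rewrite [RHS]skew_hom_tensor_apply coadjoint_dual_sum_r.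
rewrite semidirectE; congr pair.
  by rewrite !skew_hom_tensor_apply /= !linearN /= !(opp_lfunE, opprK) OT.
apply/lfunP => u; rewrite [RHS]transposeE coadjoint_dual_sum_l.
rewrite !skew_hom_tensor_apply /= add_lfunE !dual_mapE !transposeE !OT.
rewrite !(linearN, opp_lfunE, linearD) /=.
(* The summands 1 and 6, and 3 and 5, of the right-hand side are opposite. *)
by rewrite [RHS](AC (3*3) ((2*4)*((6*1)*(3*5)))) /= !subrr !addr0.
Qed.

(** A functional with prescribed components [(h, 0)] or [(0, v)] isolates one of
    the two relations.  Exchanging [(f, g)] with [(f', g')] exchanges these
    relations, so both differential conditions of the AYBE have the same
    content. *)
Lemma skew_intertwines m (f f' : 'I_m -> 'End(A)) (g g' : 'I_m -> 'End(V)) :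
  (forall k (phi : dual Ahat), s (transpose (sum_fam f (dual_fam g) k) phi) =
     sum_fam f' (dual_fam g') k (s phi)) <->
  (forall k, (f k \o T)%VF = (T \o g' k)%VF) /\
  (forall k, (T \o g k)%VF = (f' k \o T)%VF).
Proof.
have sum_l k (phi : dual Ahat) :
    dual_sum_l (transpose (sum_fam f (dual_fam g) k) phi) =
    transpose (f k) (dual_sum_l phi).
  by apply/lfunP => a; rewrite transposeE !dual_sum_lE transposeE sum_famE linear0.
have sum_r k (phi : dual Ahat) :
    dual_sum_r (transpose (sum_fam f (dual_fam g) k) phi) = g k (dual_sum_r phi).
  apply: dual_separates => xi; rewrite dual_sum_rE transposeE sum_famE linear0.
  by rewrite -dual_sum_rE transposeE.
split=> [E | [fT Tg] k phi].
  split=> k; apply/lfunP => v; rewrite !comp_lfunE.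
    apply: dual_separates => h; have [phi [phi_l _]] := dual_sum_surj h (0 : V).
    have := E k phi; rewrite !skew_hom_tensor_apply sum_famE sum_l sum_r phi_l /=.
    move=> /(congr1 (@snd A (dual V))) /lfunP /(_ v) /=.
    by rewrite !transposeE.
  have [phi [_ phi_r]] := dual_sum_surj (0 : dual A) v.
  have := E k phi; rewrite !skew_hom_tensor_apply sum_famE sum_l sum_r phi_r /=.
  by move=> /(congr1 (@fst A (dual V))) /=; rewrite linearN /= => /oppr_inj.
rewrite !skew_hom_tensor_apply sum_famE sum_l sum_r /=; congr pair.
  by rewrite linearN /= -!comp_lfunE Tg.
by apply/lfunP => v; rewrite !transposeE -!comp_lfunE fT.
Qed.

End SkewHom.

Lemma skew_admissible_AYBE (F : fieldType) (A V : vectType F) m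
    (mu : 'Hom(A, 'End(A))) (l r : 'Hom(A, 'End(V))) (T : 'Hom(V, A))
    (Phi Psi : 'I_m -> 'End(A)) (Pi Omega : 'I_m -> 'End(V)) :
  let s := hom_tensor T - flip _ _ (hom_tensor T) in
  admissible_AYBE (semidirect mu (dual_map r) (dual_map l))
    (sum_fam Phi (dual_fam Pi)) (sum_fam Psi (dual_fam Omega)) s <->
  [/\ O_operator mu l r T,
      forall k, (Phi k \o T)%VF = (T \o Omega k)%VF &
      forall k, (T \o Pi k)%VF = (Psi k \o T)%VF].
Proof.
move=> s; have as_s : antisymmetric_tensor s := antisymmetric_skew _.
split=> [[aybe /tensor_intertwines/skew_intertwines[PhiT TPi] _] | [OT PhiT TPi]].
  by split=> //; apply/O_operator_skew/AYBE_O_operator.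
split; first exact/(AYBE_O_operator _ as_s)/O_operator_skew.
  exact/tensor_intertwines/skew_intertwines.
by apply/tensor_intertwines/skew_intertwines; split=> k; rewrite ?PhiT ?TPi.
Qed.

Theorem theorem4p18 (F : fieldType) (char0 : [pchar F] =i pred0)
    (A V : vectType F) (m : nat)
    (mu : 'Hom(A, 'End(A))) (Phi : 'I_m -> 'End(A))
    (l r : 'Hom(A, 'End(V))) (Pi : 'I_m -> 'End(V))
    (Psi : 'I_m -> 'End(A)) (Omega : 'I_m -> 'End(V)) (T : 'Hom(V, A))
    (diffA : diff_algebra mu Phi) (bimV : bimodule mu l r)
    (admPi : admissible mu Phi l r Pi)
    (commPsi : commuting Psi) (commOmega : commuting Omega) :
  let Ahat : vectType F := (A * dual V)%type in
  let muhat : 'Hom(Ahat, 'End(Ahat)) :=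
    semidirect mu (dual_map r) (dual_map l) in
  let Phihat : 'I_m -> 'End(Ahat) := sum_fam Phi (dual_fam Pi) in
  let Psihat : 'I_m -> 'End(Ahat) := sum_fam Psi (dual_fam Omega) in
  let s : tensor Ahat Ahat := hom_tensor T - flip Ahat Ahat (hom_tensor T) in
  [/\ diff_algebra muhat Phihat /\ commuting Psihat,
      (antisymmetric_tensor s /\ admissible_AYBE muhat Phihat Psihat s) <->
      [/\ O_operator mu l r T,
          forall k, (Phi k \o T)%VF = (T \o Omega k)%VF &
          forall k, (T \o Pi k)%VF = (Psi k \o T)%VF] &
      diff_bimodule mu Phi l r Omega ->
      diff_O_operator mu Phi l r Omega T ->
      (forall k, (T \o Pi k)%VF = (Psi k \o T)%VF) ->
      (antisymmetric_tensor s /\ admissible_AYBE muhat Phihat Psihat s) /\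
      (self_admissible mu Phi Psi ->
       (forall k a v, l (Psi k a) v = l a (Omega k v) + Pi k (l a v)) ->
       (forall k a v, r (Psi k a) v = r a (Omega k v) + Pi k (r a v)) ->
       self_admissible muhat Phihat Psihat /\
       diff_ASI_bialgebra muhat (coboundary muhat s) Phihat Psihat)].
Proof.
move=> Ahat muhat Phihat Psihat s.
have [_ dual_bim] := admPi; have [assoc _ _] := diffA.
have as_s : antisymmetric_tensor s := antisymmetric_skew _.
have diffAhat : diff_algebra muhat Phihat by exact: semidirect_diff_algebra.
have aybeP := skew_admissible_AYBE mu l r T Phi Psi Pi Omega.
split.
- by split=> //; apply/commuting_sum_fam/commuting_dual_fam.
- by split=> [[_ /aybeP] | /aybeP].
move=> bimOmega [OT PhiT] TPi.
have aybe : admissible_AYBE muhat Phihat Psihat s by apply/aybeP.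
split=> // adm Hl Hr.
have admhat : self_admissible muhat Phihat Psihat.
  exact: semidirect_dual_admissible.
by split=> //; apply: coboundary_diff_ASI_bialgebra.
Qed.
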